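(* Let $C_{(=,\leq)}(x,y)$ be the bivariate generating function of the Catalan words avoiding the ordered pair of relations $(=,\leq)$, where $x$ marks the length and $y$ marks the number of descents. Then $$C_{(=,\leq)}(x,y)=\frac{1 - x + 2 x y - \sqrt{1 - 2 x + x^2 - 4 x^2 y - 4 x^3 y}}{2xy}.$$
   Context: A Catalan word of length $n$ is a word $w=w_1w_2\cdots w_n$ over the non-negative integers with $w_1=0$ and $0\leq w_i\leq w_{i-1}+1$ for $i=2,\dots,n$; the empty word is the unique Catalan word of length $0$. For relations $X,Y\in\{<,>,\leq,\geq,=,\neq\}$, a word $w$ contains the pattern $(X,Y)$ if there is an index $i\geq 1$ (with $i+2\le n$) such that $w_i\,X\,w_{i+1}$ and $w_{i+1}\,Y\,w_{i+2}$; otherwise $w$ avoids $(X,Y)$. The number of descents $\mathrm{des}(w)$ is the number of indices $i$ with $w_i>w_{i+1}$. The bivariate generating function is $C_{(X,Y)}(x,y)=\sum_{w}x^{|w|}y^{\mathrm{des}(w)}$, the sum being over all Catalan words $w$ (of any length $|w|\geq 0$) avoiding $(X,Y)$. Identities are between formal power series in $x$ with coefficients polynomials in $y$ (after clearing denominators); the square root of a power series with constant term $1$ is the one with constant term $1$. *)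

(* Defs.v *)
From HB Require Import structures.
From mathcomp Require Import all_boot all_order all_algebra.
From mathcomp Require Import boolp classical_sets.

Set Implicit Arguments.
Unset Strict Implicit.
Unset Printing Implicit Defensive.

Import GRing.Theory.

Local Open Scope ring_scope.

(* A record rather than an alias of [nat -> A]: functions already carry the
   pointwise product, and series need the Cauchy product. *)
Record fps (A : Type) : Type := FPS { fps_coef : nat -> A }.

Lemma fpsP (A : Type) (f g : fps A) :
  (forall n, fps_coef f n = fps_coef g n) -> f = g.
Proof. by case: f g => [f] [g] /= fg; congr FPS; apply: funext. Qed.

HB.instance Definition _ (A : Type) := gen_eqMixin (fps A).
HB.instance Definition _ (A : Type) := gen_choiceMixin (fps A).

Section FpsRing.
Variable A : comNzRingType.
Implicit Types f g h : fps A.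

Definition fps_zero : fps A := FPS (fun _ => 0).
Definition fps_opp f : fps A := FPS (fun n => - fps_coef f n).
Definition fps_add f g : fps A := FPS (fun n => fps_coef f n + fps_coef g n).
Definition fpsC (c : A) : fps A := FPS (fun n => if n == 0%N then c else 0).
Definition fps_mul f g : fps A :=
  FPS (fun n => \sum_(i < n.+1) fps_coef f i * fps_coef g (n - i)%N).

Fact fps_addA : associative fps_add.
Proof. by move=> f g h; apply: fpsP => n /=; rewrite addrA. Qed.
Fact fps_addC : commutative fps_add.
Proof. by move=> f g; apply: fpsP => n /=; rewrite addrC. Qed.
Fact fps_add0 : left_id fps_zero fps_add.
Proof. by move=> f; apply: fpsP => n /=; rewrite add0r. Qed.
Fact fps_addN : left_inverse fps_zero fps_opp fps_add.
Proof. by move=> f; apply: fpsP => n /=; rewrite addNr. Qed.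

HB.instance Definition _ :=
  GRing.isZmodule.Build (fps A) fps_addA fps_addC fps_add0 fps_addN.

Let trunc n f : {poly A} := \poly_(i < n.+1) fps_coef f i.

Let coef_trunc n f i : (i <= n)%N -> (trunc n f)`_i = fps_coef f i.
Proof. by move=> le_in; rewrite coef_poly ltnS le_in. Qed.

Let coef_mul_trunc n f g i :
  (i <= n)%N -> (trunc n f * trunc n g)`_i = fps_coef (fps_mul f g) i.
Proof.
move=> le_in; rewrite coefM; apply: eq_bigr => j _.
rewrite !coef_trunc //; first exact: leq_trans (leq_subr _ _) le_in.
by apply: leq_trans le_in; rewrite -ltnS.
Qed.

Fact fps_mulC : commutative fps_mul.
Proof.
by move=> f g; apply: fpsP => n; rewrite -!(coef_mul_trunc _ _ (leqnn n)) mulrC.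
Qed.

Fact fps_mulA : associative fps_mul.
Proof.
move=> f g h; apply: fpsP => n.
transitivity (trunc n f * (trunc n g * trunc n h))`_n.
  rewrite coefM; apply: eq_bigr => i _.
  by rewrite coef_trunc ?coef_mul_trunc ?leq_subr // -ltnS.
rewrite mulrA coefM; apply: eq_bigr => i _.
by rewrite coef_mul_trunc ?coef_trunc ?leq_subr // -ltnS.
Qed.

Fact fps_mul1 : left_id (fpsC 1) fps_mul.
Proof.
move=> f; apply: fpsP => n /=.
rewrite big_ord_recl /= mul1r subn0 big1 ?addr0 // => i _.
by rewrite mul0r.
Qed.

Fact fps_mulDl : left_distributive fps_mul fps_add.
Proof.
move=> f g h; apply: fpsP => n /=; rewrite -big_split /=.
by apply: eq_bigr => i _; rewrite mulrDl.
Qed.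

Fact fps_one_neq0 : fpsC 1 != 0.
Proof.
apply/eqP => /(congr1 (fun f : fps A => fps_coef f 0%N)) /= /eqP.
by rewrite oner_eq0.
Qed.

HB.instance Definition _ :=
  GRing.Zmodule_isComNzRing.Build (fps A)
    fps_mulA fps_mulC fps_mul1 fps_mulDl fps_one_neq0.

Definition fpsX : fps A := FPS (fun n => (n == 1%N)%:R).

(* The square root with constant term 1; junk (1) when there is none. *)
Definition fps_sqrt f : fps A :=
  xget 1 [set s : fps A | fps_coef s 0 = 1 /\ s ^+ 2 = f].

Lemma fps_coefM f g n :
  fps_coef (f * g) n = \sum_(i < n.+1) fps_coef f i * fps_coef g (n - i)%N.
Proof. by []. Qed.

End FpsRing.

Arguments fpsX {A}.

(* Over a domain in which 2 is invertible, [fps_sqrt] is not junk. *)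
Section FpsSqrt.
Variable A : idomainType.
Hypothesis unit2 : (2%:R : A) \is a GRing.unit.
Implicit Types f s t : fps A.

Let coef_sqr0 s n : fps_coef s 0 = 1 ->
  fps_coef (s ^+ 2) n.+1 = fps_coef s n.+1 *+ 2
    + \sum_(i < n) fps_coef s i.+1 * fps_coef s (n - i)%N.
Proof.
move=> s0; rewrite expr2 fps_coefM big_ord_recl big_ord_recr /= subn0 subnn s0.
rewrite mul1r /bump /= add1n mulr1 mulr2n addrAC -addrA addrC addrA.
by congr (_ + _); rewrite addrC.
Qed.

Lemma fps_sqrt_inj s t :
  fps_coef s 0 = 1 -> fps_coef t 0 = 1 -> s ^+ 2 = t ^+ 2 -> s = t.
Proof.
move=> s0 t0 est; apply: fpsP.
elim/ltn_ind=> -[_|n IHn]; first by rewrite s0 t0.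
have e : fps_coef (s ^+ 2) n.+1 = fps_coef (t ^+ 2) n.+1 by rewrite est.
rewrite !coef_sqr0 // in e.
have eS : \sum_(i < n) fps_coef s i.+1 * fps_coef s (n - i)%N =
          \sum_(i < n) fps_coef t i.+1 * fps_coef t (n - i)%N.
  apply: eq_bigr => i _; rewrite !IHn // ltnS ?leq_subr //.
move: e; rewrite eS => /addIr.
rewrite -[LHS]mulr_natr -[RHS]mulr_natr; exact: mulIr.
Qed.

(* Coefficients 0 .. n of the root, computed by successive extension. *)
Let fix_sqrt f := fix loop n : seq A :=
  if n is m.+1 then
    let r := loop m in
    rcons r ((fps_coef f n - \sum_(i < m) r`_i.+1 * r`_(m - i)) / 2%:R)
  else [:: 1].

Let size_sqrt f n : size (fix_sqrt f n) = n.+1.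
Proof. by elim: n => //= n IHn; rewrite size_rcons IHn. Qed.

Let nth_sqrt f n i : (i <= n)%N -> (fix_sqrt f n)`_i = (fix_sqrt f i)`_i.
Proof.
elim: n => [|n IHn]; first by rewrite leqn0 => /eqP ->.
rewrite leq_eqVlt => /orP[/eqP -> //|lt_in].
by rewrite /= nth_rcons size_sqrt lt_in IHn.
Qed.

Lemma fps_sqrt_ex f : fps_coef f 0 = 1 ->
  exists s, fps_coef s 0 = 1 /\ s ^+ 2 = f.
Proof.
move=> f0; pose s := FPS (fun n => (fix_sqrt f n)`_n).
have s0 : fps_coef s 0 = 1 by [].
exists s; split=> //; apply: fpsP => -[|n].
  by rewrite expr2 fps_coefM big_ord1 subn0 s0 mulr1 f0.
rewrite coef_sqr0 // /s /= nth_rcons size_sqrt ltnn eqxx.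
rewrite -[X in X + _]mulr_natr divrK //.
rewrite [X in _ - X](_ : _ = \sum_(i < n)
  (fix_sqrt f i.+1)`_i.+1 * (fix_sqrt f (n - i)%N)`_(n - i)); last first.
  by apply: eq_bigr => i _; rewrite !nth_sqrt // leq_subr.
by rewrite subrK.
Qed.

Lemma fps_sqrtP f : fps_coef f 0 = 1 ->
  fps_coef (fps_sqrt f) 0 = 1 /\ fps_sqrt f ^+ 2 = f.
Proof. by move=> /fps_sqrt_ex; apply: xgetPex. Qed.

Lemma fps_sqrt_unique s : fps_coef s 0 = 1 -> fps_sqrt (s ^+ 2) = s.
Proof.
move=> s0; apply: xget_unique => // t [t0 e]; exact: fps_sqrt_inj.
Qed.

End FpsSqrt.

Lemma polyrat_unit2 : (2%:R : {poly rat}) \is a GRing.unit.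
Proof. by rewrite -polyC_natr rmorph_unit. Qed.

Definition is_catalan (w : seq nat) : bool :=
  (head 0%N w == 0%N) && sorted (fun a b => b <= a.+1)%N w.

Definition contains_pair (X Y : rel nat) (w : seq nat) : bool :=
  has (fun i => X (nth 0%N w i) (nth 0%N w i.+1)
                && Y (nth 0%N w i.+1) (nth 0%N w i.+2))
      (iota 0 (size w - 2)).

Definition avoids_pair (X Y : rel nat) (w : seq nat) : bool :=
  ~~ contains_pair X Y w.

Definition des (w : seq nat) : nat :=
  count (fun i => nth 0 w i.+1 < nth 0 w i)%N (iota 0 (size w).-1).

(* Every letter of a Catalan word of length n is smaller than n, so these words
   are the words [map val t] with [t : n.-tuple 'I_n]. *)
Lemma is_catalan_tuple (w : seq nat) : is_catalan w ->
  exists t : (size w).-tuple 'I_(size w), w = map val t.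
Proof.
move=> /andP[/eqP w0 /(sortedP 0%N) sw].
have lt_nth i : (i < size w)%N -> (nth 0%N w i <= i)%N.
  elim: i => [|i IHi] ltiw; first by rewrite nth0 w0.
  by apply: leq_trans (sw i ltiw) _; rewrite ltnS IHi // ltnW.
have ltw (i : 'I_(size w)) : (nth 0%N w i < size w)%N.
  exact: leq_ltn_trans (lt_nth i (ltn_ord i)) (ltn_ord i).
exists [tuple Ordinal (ltw i) | i < size w].
apply: (@eq_from_nth _ 0%N) => [|i ltiw]; first by rewrite size_map size_tuple.
have := tnth_mktuple (fun i => Ordinal (ltw i)) (Ordinal ltiw).
rewrite (tnth_nth (Ordinal ltiw)) => e.
by rewrite (nth_map (Ordinal ltiw)) ?size_tuple //= e.
Qed.

(* The variable y of the generating function is ['X : {poly rat}]. *)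
Definition catalan_gf (X Y : rel nat) : fps {poly rat} :=
  FPS (fun n => \sum_(t : n.-tuple 'I_n |
                      is_catalan (map val t) && avoids_pair X Y (map val t))
                  'X^(des (map val t))).

(* Main.v *)
Require Import Defs.
From mathcomp Require Import all_boot all_order all_algebra.
From mathcomp Require Import ring.

(** A nonempty Catalan word factors uniquely as [0 (u+1) v] with [u] and [v]
    Catalan.  If [u] is empty, avoiding [(=, <=)] leaves only [0] and [00].
    Otherwise no occurrence of [(=, <=)] can straddle the factors, since [v]
    starts with a 0 that is preceded by a positive letter; this same place is a
    descent as soon as [v] is nonempty.  Hence the series [D] of nonempty words
    satisfies [D = x + x^2 + x D (1 + y D)], and the square root arises by
    completing the square. *)

Set Implicit Arguments.
Unset Strict Implicit.
Unset Printing Implicit Defensive.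

Import GRing.Theory.

(** * Catalan condition, pattern occurrences and descents across a factorisation *)

Section CatalanWords.
Local Open Scope nat_scope.

Lemma contains_pair_cons (X Y : rel nat) (a b c : nat) (s : seq nat) :
  contains_pair X Y [:: a, b, c & s] =
  X a b && Y b c || contains_pair X Y [:: b, c & s].
Proof.
(* Rewriting 1 as [1 + 0] makes the later indices a shift of those of the tail. *)
rewrite /contains_pair /= !subSS subn0 /= -(addn0 1) iotaDl has_map.
by congr (_ || _); apply: eq_has.
Qed.

Lemma des_cons (a b : nat) (s : seq nat) :
  des [:: a, b & s] = (b < a) + des (b :: s).
Proof.
rewrite /des /= -(addn0 1) iotaDl count_map.
by congr (_ + _); apply: eq_count.
Qed.

(** After the leading 0 the shifted [u] may only start with 1, so [u] starts with 0; the passage to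
    a 0 opening [v] is always allowed. *)
Lemma is_catalan_decomp (u v : seq nat) : head 0 v = 0 ->
  is_catalan (0 :: map S u ++ v) = is_catalan u && is_catalan v.
Proof.
move=> v0; rewrite /is_catalan v0 eqxx /= cat_path; congr (_ && _).
  by case: u => [|a u] //=; rewrite path_map ltnS leqn0.
by case: v v0 => [|b v] //= ->.
Qed.

Let contains := contains_pair (fun a b => a == b) (fun a b => a <= b).

(** A window of three letters across the cut has a positive letter followed by 0, which satisfies
    neither [=] nor [<=]. *)
Lemma contains_shift_cat (u v : seq nat) : u != [::] -> head 0 v = 0 ->
  contains (map S u ++ v) = contains u || contains v.
Proof.
move=> u0 v0; elim: u u0 => // a [|b u] IHu _.
  by case: v v0 {IHu} => [|? [|c v]] //= ->; rewrite /contains contains_pair_cons.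
have {}IHu := IHu isT; case: u IHu => [|c u] /= IHu.
  case: v v0 IHu => [|d v] //= -> IHu.
  by rewrite /contains contains_pair_cons andbF.
by rewrite /contains !contains_pair_cons eqSS ltnS -orbA; congr (_ || _).
Qed.

(** The leading 0 is followed by a positive letter, so no occurrence starts there. *)
Lemma contains_decomp (u v : seq nat) : u != [::] -> head 0 v = 0 ->
  contains (0 :: map S u ++ v) = contains u || contains v.
Proof.
move=> u0 v0; rewrite -contains_shift_cat //.
by case: u u0 => [|a [|b u]] //= _; first case: v v0 => [|b v] //= _;
  rewrite /contains contains_pair_cons.
Qed.

(** The summand [v != [::]] counts the descent at the cut. *)
Lemma des_shift_cat (u v : seq nat) : u != [::] -> head 0 v = 0 ->
  des (map S u ++ v) = des u + ((v != [::]) + des v).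
Proof.
move=> u0 v0; elim: u u0 => // a [|b u] IHu _.
  by case: v v0 {IHu} => [|? v] //= ->; rewrite des_cons.
by rewrite /= !des_cons ltnS -addnA; congr (_ + _); apply: IHu.
Qed.

Lemma des_decomp (u v : seq nat) : u != [::] -> head 0 v = 0 ->
  des (0 :: map S u ++ v) = des u + ((v != [::]) + des v).
Proof.
by move=> u0 v0; rewrite -des_shift_cat //; case: u u0 => [|a u] //= _;
  rewrite des_cons.
Qed.

(** * Avoiding words, listed by length *)

Definition good (w : seq nat) : bool :=
  is_catalan w && avoids_pair (fun a b => a == b) (fun a b => a <= b) w.

Lemma good_head (w : seq nat) : good w -> head 0 w = 0.
Proof. by case/andP => /andP[/eqP]. Qed.

Lemma good_decomp (u v : seq nat) : u != [::] -> head 0 v = 0 ->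
  good (0 :: map S u ++ v) = good u && good v.
Proof.
move=> u0 v0; rewrite /good /avoids_pair is_catalan_decomp //.
by rewrite [contains_pair _ _ _]contains_decomp // negb_or andbACA.
Qed.

(** Listed through tuples, to match the index set of the sum in [catalan_gf]. *)
Definition good_words (n : nat) : seq (seq nat) :=
  [seq map val (tval t) | t : n.-tuple 'I_n <- enum {: n.-tuple 'I_n} & good (map val t)].

Lemma mem_good_words (n : nat) (w : seq nat) :
  (w \in good_words n) = (size w == n) && good w.
Proof.
apply/mapP/andP => [[t]|[/eqP <- gw]].
  by rewrite mem_filter => /andP[gt _] ->; rewrite size_map size_tuple.
have [t wt] := is_catalan_tuple (proj1 (andP gw)).
by exists t; rewrite // mem_filter mem_enum -wt gw.
Qed.

Lemma uniq_good_words (n : nat) : uniq (good_words n).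
Proof.
rewrite map_inj_uniq => [|s t]; first exact/filter_uniq/enum_uniq.
by move/(inj_map val_inj)/val_inj.
Qed.

(** * Existence and uniqueness of the factorisation *)

(** The first 0 marks the cut; if [v] is empty, [find] returns the total length, which is again
    [size u]. *)
Lemma find0_shift_cat (u v : seq nat) : head 0 v = 0 ->
  find (pred1 0) (map S u ++ v) = size u.
Proof.
move=> v0; rewrite find_cat has_map (@eq_has _ _ pred0) // has_pred0 size_map.
by case: v v0 => [|b v] /=; [rewrite addn0 | move=> ->; rewrite addn0].
Qed.

Lemma shift_cat_inj (u v u' v' : seq nat) : head 0 v = 0 -> head 0 v' = 0 ->
  map S u ++ v = map S u' ++ v' -> u = u' /\ v = v'.
Proof.
move=> v0 v'0 e; have := congr1 (find (pred1 0)) e.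
rewrite !find0_shift_cat // => es; move/eqP: e.
rewrite eqseq_cat ?size_map // => /andP[/eqP e /eqP ->]; split=> //.
exact: (inj_map succn_inj).
Qed.

Lemma shift_cat_ex (s : seq nat) :
  exists u v, s = map S u ++ v /\ head 0 v = 0.
Proof.
elim: s => [|[|a] s [u [v [-> v0]]]]; first by exists [::], [::].
  by exists [::], (0 :: map S u ++ v).
by exists (a :: u), v.
Qed.

Lemma good_decomp_ex (w : seq nat) : 2 < size w -> good w ->
  exists u v, [/\ w = 0 :: map S u ++ v, u != [::], good u & good v].
Proof.
move=> szw gw; have := good_head gw; case: w szw gw => [|a s] //= szw gw a0.
have [u [v [es v0]]] := shift_cat_ex s; subst a s; exists u, v.
(* With [u] empty the word would begin with 0, 0, b, an occurrence since [0 <= b]. *)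
have u0 : u != [::].
  apply: contraL gw => /eqP eu; move: szw; rewrite eu.
  case: v v0 => [|a [|b v]] //= -> _.
  by rewrite /good /avoids_pair contains_pair_cons andbF.
by move: gw; rewrite good_decomp // => /andP[].
Qed.

Definition word_pairs (m n : nat) : seq (seq nat * seq nat) :=
  [seq (u, v) | u <- good_words m, v <- good_words n].

Lemma mem_word_pairs (m n : nat) (p : seq nat * seq nat) :
  (p \in word_pairs m n) = (p.1 \in good_words m) && (p.2 \in good_words n).
Proof.
apply/allpairsP/andP => [[[u v] [/= ? ? ->]] //|[? ?]].
by exists p; split=> //; apply: surjective_pairing.
Qed.

(** The index [i] is the length of [u]. The bound on [n] sets aside the words 0 and 00, where [u] is
    empty. *)
Lemma good_words_rec (n : nat) : 1 < n ->
  perm_eq (good_words n.+1)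
    [seq 0 :: map S p.1 ++ p.2 | i <- iota 1 n, p <- word_pairs i (n - i)].
Proof.
move=> n_gt1; apply: uniq_perm; first exact: uniq_good_words.
  apply: allpairs_uniq_dep => [|i _|]; first exact: iota_uniq.
    by apply: allpairs_uniq; rewrite ?uniq_good_words // => -[? ?] [? ?].
  (* Injectivity: the word determines [u] and [v], hence also [i] as [size u]. *)
  move=> p q /allpairsPdep[i [[u v] [_ + ->{p}]]].
  rewrite mem_word_pairs /= !mem_good_words => /andP[/andP[/eqP <- _] /andP[_ gv]].
  move=> /allpairsPdep[j [[u' v'] [_ + ->{q}]]].
  rewrite mem_word_pairs /= !mem_good_words.
  move=> /andP[/andP[/eqP <- _] /andP[_ gv']] /= [].
  by move=> /(shift_cat_inj (good_head gv) (good_head gv'))[-> ->].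
move=> w; apply/idP/allpairsPdep => [|[i [[u v] [+ + ->]]]].
  rewrite mem_good_words => /andP[/eqP szw gw].
  have [|u [v [ew u0 gu gv]]] := good_decomp_ex _ gw; first by rewrite szw.
  have szn : size u + size v = n.
    by apply: succn_inj; rewrite -szw ew /= size_cat size_map.
  exists (size u), (u, v); split=> //.
    by rewrite mem_iota lt0n size_eq0 u0 -szn /= ltnS leq_addr.
  by rewrite mem_word_pairs !mem_good_words /= gu gv eqxx -szn addKn eqxx.
rewrite mem_iota mem_word_pairs /= !mem_good_words.
move=> /andP[i_gt0 ltin] /andP[/andP[/eqP szu gu] /andP[/eqP szv gv]].
have u0 : u != [::] by rewrite -size_eq0 szu -lt0n.
by rewrite good_decomp ?good_head // gu gv /= size_cat size_map szu szv subnKC ?eqxx.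
Qed.

End CatalanWords.

(** * Coefficients of the generating function *)

Local Open Scope ring_scope.

Local Notation gf := (catalan_gf (fun a b => a == b) (fun a b => (a <= b)%N)).

Lemma gf_coef (n : nat) :
  fps_coef gf n = \sum_(w <- good_words n) 'X^(des w).
Proof. by rewrite big_map big_filter big_enum_cond. Qed.

Lemma gf_coef_perm (n : nat) (s : seq (seq nat)) : uniq s ->
  (forall w, (w \in s) = (size w == n) && good w) ->
  fps_coef gf n = \sum_(w <- s) 'X^(des w).
Proof.
move=> us ms; rewrite gf_coef; apply/perm_big/uniq_perm => //.
  exact: uniq_good_words.
by move=> w; rewrite ms mem_good_words.
Qed.

Lemma gf_coef0 : fps_coef gf 0 = 1.
Proof.
by rewrite (@gf_coef_perm 0 [:: [::]]) ?big_seq1 // => -[|a w]; rewrite inE.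
Qed.

Lemma gf_coef1 : fps_coef gf 1 = 1.
Proof.
rewrite (@gf_coef_perm 1 [:: [:: 0%N]]) ?big_seq1 // => -[|a [|b w]] //.
by rewrite inE eqseq_cons andbF.
Qed.

Lemma gf_coef2 : fps_coef gf 2 = 2.
Proof.
rewrite (@gf_coef_perm 2 [:: [:: 0%N; 0%N]; [:: 0%N; 1%N]]) //.
  by rewrite big_cons big_seq1.
case=> [|a [|b [|c w]]] //; first by rewrite !inE !eqseq_cons !andbF.
  rewrite !inE !eqseq_cons !andbT /good /is_catalan /= !andbT.
  by case: a => [|a] //; case: b => [|[|b]].
by rewrite !inE !eqseq_cons !andbF.
Qed.

(** The factor ['X^(i != n)] records the descent at the cut, present exactly when [v], of length
    [n - i], is nonempty. *)
Lemma gf_coef_rec (n : nat) : (1 < n)%N -> fps_coef gf n.+1 =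
  \sum_(1 <= i < n.+1)
    fps_coef gf i * ('X^(i != n) * fps_coef gf (n - i)).
Proof.
move=> n_gt1; rewrite gf_coef (perm_big _ (good_words_rec n_gt1)).
rewrite big_allpairs_dep /index_iota subn1.
rewrite big_seq [RHS]big_seq; apply: eq_bigr => i.
rewrite mem_iota => /andP[i_gt0 ltin].
rewrite big_allpairs !gf_coef mulr_suml.
rewrite big_seq [RHS]big_seq; apply: eq_bigr => u.
rewrite mem_good_words => /andP[/eqP szu gu]; rewrite !mulr_sumr.
rewrite big_seq [RHS]big_seq; apply: eq_bigr => v.
rewrite mem_good_words => /andP[/eqP szv gv] /=.
rewrite des_decomp ?good_head ?exprD -?size_eq0 ?szu -?lt0n // szv.
by rewrite subn_gt0 ltn_neqAle -ltnS ltin andbT mulrA.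
Qed.

(** * Coefficient rules and the functional equation *)

Lemma fps_coefXM (A : comNzRingType) (f : fps A) (n : nat) :
  fps_coef (fpsX * f) n.+1 = fps_coef f n.
Proof.
rewrite fps_coefM big_ord_recl big_ord_recl /= mul0r add0r mul1r subSS subn0.
by rewrite big1 ?addr0 // => i _; rewrite mul0r.
Qed.

Lemma fps_coefCM (A : comNzRingType) (c : A) (f : fps A) (n : nat) :
  fps_coef (fpsC c * f) n = c * fps_coef f n.
Proof.
rewrite fps_coefM big_ord_recl /= subn0.
by rewrite big1 ?addr0 // => i _; rewrite mul0r.
Qed.

Lemma fps_coef0M (A : comNzRingType) (f g : fps A) :
  fps_coef (f * g) 0 = fps_coef f 0 * fps_coef g 0.
Proof. by rewrite fps_coefM big_ord1. Qed.

Lemma fps_coefD (A : comNzRingType) (f g : fps A) (n : nat) :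
  fps_coef (f + g) n = fps_coef f n + fps_coef g n.
Proof. by []. Qed.

Lemma fps_coef1 (A : comNzRingType) (n : nat) :
  fps_coef (1 : fps A) n = (n == 0%N)%:R.
Proof. by case: n. Qed.

(** The series [E] of the proof counts the choices of [v]: 1 for the empty word, and an extra factor
    y for each nonempty one. Degrees up to 2 are compared explicitly, the others through
    [gf_coef_rec]. *)
Lemma gf_equation :
  gf = 1 + fpsX * (1 + fpsX + (gf - 1) * (1 + fpsC 'X * (gf - 1))).
Proof.
set D := gf - 1; set E := 1 + fpsC 'X * D.
have D0 : fps_coef D 0 = 0 by rewrite fps_coefD gf_coef0 subrr.
have DS n : fps_coef D n.+1 = fps_coef gf n.+1.
  by rewrite fps_coefD [X in _ + X]oppr0 addr0.
have E0 : fps_coef E 0 = 1.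
  by rewrite fps_coefD fps_coefCM D0 mulr0 addr0.
have ES n : fps_coef E n.+1 = 'X * fps_coef gf n.+1.
  by rewrite fps_coefD fps_coefCM DS add0r.
apply: fpsP => -[|n].
  by rewrite gf_coef0 fps_coefD fps_coef0M mul0r addr0.
rewrite fps_coefD fps_coefXM fps_coef1 add0r !fps_coefD fps_coef1.
case: n => [|[|n]].
- by rewrite gf_coef1 fps_coef0M D0 mul0r !addr0.
- rewrite gf_coef2 fps_coefM big_ord_recl big_ord1 D0 mul0r DS gf_coef1 E0.
  by rewrite mulr1 !add0r.
rewrite gf_coef_rec // fps_coefM !add0r big_ord_recl D0 mul0r add0r.
rewrite big_add1 big_mkord; apply: eq_bigr => i _.
(* Now [u] has length [i + 1], so [v] is empty exactly when [i = n + 1]. *)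
rewrite DS lift0 subSS; congr (_ * _); case: (ltngtP i n.+1) => [ltin|gtin|->].
- by rewrite subSn // ES neq_ltn ltnS ltin.
- by move: (ltn_ord i); rewrite ltnS leqNgt gtin.
- by rewrite subnn E0 eqxx mul1r gf_coef0.
Qed.

(** * Completing the square *)

Theorem theorem3p4 :
  let x : fps {poly rat} := fpsX in
  let y : fps {poly rat} := fpsC 'X in
  2 * x * y * catalan_gf (fun a b => a == b) (fun a b => (a <= b)%N) =
  1 - x + 2 * x * y
  - fps_sqrt (1 - 2 * x + x ^+ 2 - 4 * x ^+ 2 * y - 4 * x ^+ 3 * y).
Proof.
move=> x y; set D := gf - 1.
have eD : 0 = D - x * (1 + x + D * (1 + y * D)).
  by apply/esym/eqP; rewrite subr_eq0 /D {1}gf_equation addrAC subrr add0r.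
(* Up to sign, [s] is the derivative in [D] of the quadratic [x y D^2 - (1 - x) D + x + x^2]; its
   constant term 1 selects the right branch of the root. *)
pose s := 1 - x * (1 + 2 * y * D).
have s0 : fps_coef s 0 = 1.
  rewrite -[LHS]/(1 - fps_coef (x * (1 + 2 * y * D)) 0).
  by rewrite fps_coef0M mul0r subr0.
have -> : 1 - 2 * x + x ^+ 2 - 4 * x ^+ 2 * y - 4 * x ^+ 3 * y = s ^+ 2.
  (* Subtracting [4 x y] times the vanishing right-hand side of [eD] makes this a polynomial
     identity in [x], [y], [D]. *)
  rewrite -[LHS]subr0 -(mulr0 (4 * x * y)) {1}eD /s; ring.
rewrite fps_sqrt_unique //; last exact: polyrat_unit2.
rewrite /s /D; ring.
Qed.
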